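(* Let $G=(V,E)$ be a finite strongly connected directed graph with transition matrix $H$, and let $\mu$ be the stationary distribution of $H$ (a probability row vector with $\mu H=\mu$). Suppose that $H$ is reversible, i.e. $H(v,w)\mu(v)=H(w,v)\mu(w)$ for all $v,w\in V$. Consider the pull voter model with agnostic nodes on $G$ with matrix $H$ (either synchronous or asynchronous), with gnostic colours red and blue, and let $S_t$ be the configuration at time $t$. For $v\in V$ let $\mathbb{P}(R(v)\mid S_t)$ be the conditional probability, given $S_t$, that $v$ is coloured red once it is gnostic (see context). Then the sequence $$X_t=\sum_{v\in V}\mu(v)\,\mathbb{P}(R(v)\mid S_t),\qquad t\ge 0,$$ is a martingale with respect to $(S_t)_{t\ge 0}$. As a result, if $G$ is such that the process always converges on $G$, then for a fixed initial configuration $S_0$, $$\mathbb{P}(\text{red wins})=X_0 .$$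
   Context: Setting. $G=(V,E)$ is a finite strongly connected directed graph (self-loops allowed; an undirected graph is regarded as a directed graph with both orientations of each edge), $n=|V|$. The transition matrix $H$ is a row-stochastic $V\times V$ matrix with $H(v,u)>0$ if $(v,u)\in E$ and $H(v,u)=0$ otherwise. Pull voter model with agnostic nodes. Each node is, at each time, either agnostic (no colour) or gnostic; gnostic nodes are coloured red or blue. In the synchronous version, at each round every node $v$ independently selects an out-neighbour $u$ with probability $H(v,u)$. If $u$ is agnostic, $v$ keeps its current state; if $u$ is gnostic, $v$ copies the colour of $u$. All updates use the states at the start of the round and occur simultaneously. In the asynchronous version, at each round one node $v$ is chosen uniformly at random from $V$, it alone selects an out-neighbour (with probabilities $H(v,\cdot)$) and updates by the same rule; all other nodes keep their state. $S_{t+1}$ is the configuration produced from $S_t$ by round $t$. The quantity $\mathbb{P}(R(v)\mid S_t)$: it is the probability, for the process viewed as started from the configuration $S_t$, that the first gnostic colour of $v$ (from that time on) is red. In particular it equals $1$ if $v$ is red in $S_t$, equals $0$ if $v$ is blue in $S_t$, and if $v$ is agnostic in $S_t$ it is the probability that $v$ takes colour red at the moment it first becomes gnostic. Red wins means that a configuration in which all nodes are red is reached. The process always converges on $G$ if, from every initial configuration with at least one gnostic node, with probability 1 a configuration in which all nodes have the same gnostic colour is eventually reached. *)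

(* Defs.v *)
From HB Require Import structures.
From mathcomp Require Export all_boot all_order all_algebra.
From mathcomp Require Export all_classical all_reals all_analysis.

Import Order.TTheory GRing.Theory Num.Theory.
Import numFieldNormedType.Exports.
Local Open Scope classical_set_scope.
Local Open Scope ring_scope.

Section Graph.
Context {R : realType} {V : finType}.
Implicit Types (E : rel V) (H : V -> V -> R) (mu : V -> R).

Definition strongly_connected E : Prop := forall v u, connect E v u.

Definition transition_matrix E H : Prop :=
  [/\ forall v u, E v u -> 0 < H v u,
      forall v u, ~~ E v u -> H v u = 0
    & forall v, \sum_(u : V) H v u = 1].

Definition stationary H mu : Prop :=
  [/\ forall v, 0 <= mu v,
      \sum_(v : V) mu v = 1
    & forall u, \sum_(v : V) mu v * H v u = mu u].

Definition reversible H mu : Prop :=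
  forall v w, H v w * mu v = H w v * mu w.

End Graph.

Definition color : finType := bool.
Definition red : color := true.
Definition blue : color := false.

(* [None] is the agnostic state, [Some c] the gnostic state of colour [c]. *)
Definition config (V : finType) : finType := {ffun V -> option color}.

Variant schedule := Synchronous | Asynchronous.

Section VoterModel.
Context {R : realType} {V : finType}.
Implicit Types (H : V -> V -> R) (s : config V).

Definition pull s (v u : V) : option color :=
  if s u is Some c then Some c else s v.

(* [c v] is the out-neighbour selected by [v]. *)
Definition sync_update s (c : {ffun V -> V}) : config V :=
  [ffun v => pull s v (c v)].

Definition async_update s (v u : V) : config V :=
  [ffun w => if w == v then pull s v u else s w].

(* One-round transition probability from [s] to [s']: the total probability of
   the random selections turning [s] into [s'].  In the synchronous case the
   selections are independent over the nodes, whence the product. *)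
Definition voter_kernel (sch : schedule) H s s' : R :=
  match sch with
  | Synchronous =>
      \sum_(c : {ffun V -> V} | sync_update s c == s') \prod_(v : V) H v (c v)
  | Asynchronous =>
      \sum_(v : V) \sum_(u : V | async_update s v u == s') #|V|%:R^-1 * H v u
  end.

End VoterModel.

(* A discrete-time process with values in [C], bundled with the probability
   space on which it lives. *)
Record process (R : realType) (C : finType) := Process {
  space_display : measure_display;
  space : measurableType space_display;
  law : probability space R;
  state : nat -> space -> C }.
Arguments space_display {R C} p.
Arguments space {R C} p.
Arguments law {R C} p.
Arguments state {R C} p t _.

Section Processes.
Context {R : realType} {C : finType}.
Implicit Types (K : C -> C -> R) (Z : process R C).
Local Open Scope ereal_scope.

(* The initial distribution is arbitrary; multiplying out the conditional
   probability avoids conditioning on null events. *)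
Definition markov K Z : Prop :=
  (forall t c, measurable (state Z t @^-1` [set c])) /\
  (forall t (x : nat -> C),
    law Z [set w | forall i, (i <= t.+1)%N -> state Z i w = x i] =
    law Z [set w | forall i, (i <= t)%N -> state Z i w = x i]
      * (K (x t) (x t.+1))%:E).

Definition starts_at Z (c : C) : Prop :=
  law Z [set w | state Z 0%N w = c] = 1.

Definition natural_filtration Z (t : nat) : set (set (space Z)) :=
  <<s [set A | exists i c, (i <= t)%N /\ A = state Z i @^-1` [set c]] >>.

(* The last clause is the defining property of
   [E(X t.+1 | natural_filtration Z t) = X t] almost surely. *)
Definition martingale Z (X : nat -> space Z -> R) : Prop :=
  [/\ forall t (B : set R), measurable B ->
        natural_filtration Z t (X t @^-1` B),
      forall t, (law Z).-integrable setT (EFin \o X t)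
    & forall t (A : set (space Z)), natural_filtration Z t A ->
        \int[law Z]_(w in A) (X t.+1 w)%:E = \int[law Z]_(w in A) (X t w)%:E].

End Processes.

Section VoterEvents.
Context {R : realType} {V : finType}.
Implicit Types (Z : process R (config V)).

(* The first gnostic colour of [v] is red. *)
Definition first_red Z (v : V) : set (space Z) :=
  [set w | exists t, state Z t w v = Some red /\
                     forall i, (i < t)%N -> state Z i w v = None].

Definition red_wins Z : set (space Z) :=
  [set w | exists t, forall v, state Z t w v = Some red].

Definition consensus Z : set (space Z) :=
  [set w | exists t c, forall v, state Z t w v = Some c].

(* Below, [from s] is the process started from the configuration [s]. *)
Definition voter_family (sch : schedule) (H : V -> V -> R)
    (from : config V -> process R (config V)) : Prop :=
  forall s, markov (voter_kernel sch H) (from s) /\ starts_at (from s) s.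

(* P(R(v) | s) *)
Definition prob_red (from : config V -> process R (config V))
    (v : V) (s : config V) : R :=
  fine (law (from s) (first_red (from s) v)).

Definition weighted_red (from : config V -> process R (config V))
    (mu : V -> R) (s : config V) : R :=
  \sum_(v : V) mu v * prob_red from v s.

Definition always_converges (from : config V -> process R (config V)) : Prop :=
  forall s : config V, (exists v, s v <> None) ->
    law (from s) (consensus (from s)) = 1%E.

End VoterEvents.

(* Main.v *)
(* The average of P(R(v) | s') over the next configuration s' equals P(R(v) | s)
   when v is agnostic in s, by conditioning on the first round.  When v is
   gnostic, the two differ by a multiple, independent of v, of the sum over the
   gnostic u of H v u (r u - r v), where r is the indicator of red; weighted by mu
   and summed over the gnostic v this vanishes, because reversibility makes
   mu v H v u (r u - r v) antisymmetric in (v, u).  So the weighted sum X is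
   harmonic, which gives the martingale.

   X lies in [0, 1], equals 1 when all nodes are red and 0 when all are blue, so
   by induction on m it lies between P(red wins within m rounds) and
   P(red wins within m rounds) + P(no consensus within m rounds); let m tend to
   infinity.  Without any gnostic node initially, X and P(red wins) are 0. *)
Require Import Defs.
From mathcomp Require Import measurable_realfun ring lra.
Import Order.TTheory GRing.Theory Num.Theory.
Import numFieldNormedType.Exports.
Local Open Scope classical_set_scope.
Local Open Scope ring_scope.

(** * Averages over one step of a kernel *)

(** The transition operator applied to [f]; [average K f =1 f] says that [f] is harmonic. *)
Definition average {R : realType} {C : finType} (K : C -> C -> R)
    (f : C -> R) (s : C) : R :=
  \sum_(s' : C) K s s' * f s'.

(** Probability that a given node is activated in a round; with it both schedules obey one
    formula. *)
Definition update_rate {R : realType} (V : finType) (sch : schedule) : R :=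
  if sch is Synchronous then 1 else #|V|%:R^-1.

Lemma sum_antisymmetric (R : realType) (V : finType) (F : V -> V -> R) :
  (forall v w, F w v = - F v w) -> \sum_v \sum_w F v w = 0.
Proof.
move=> FN; set S := (LHS); suff: S = - S by move=> ?; lra.
rewrite {1}/S exchange_big -sumrN; apply: eq_bigr => v _.
by rewrite -sumrN; apply: eq_bigr => w _; rewrite FN.
Qed.

Lemma average_sum (R : realType) (V C : finType) (K : C -> C -> R) (a : V -> R)
    (f : V -> C -> R) s :
  average K (fun s' => \sum_v a v * f v s') s = \sum_v a v * average K (f v) s.
Proof.
rewrite /average; under eq_bigr do rewrite mulr_sumr.
rewrite exchange_big; apply: eq_bigr => v _; rewrite mulr_sumr.
by apply: eq_bigr => s' _; rewrite mulrCA.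
Qed.

(** * One round of the voter model *)

Section OneRound.
Context {R : realType} {V : finType} (H : V -> V -> R).
Hypothesis H1 : forall v, \sum_u H v u = 1.

Lemma average_sync s (f : config V -> R) :
  average (voter_kernel Synchronous H) f s =
  \sum_(c : {ffun V -> V}) (\prod_v H v (c v)) * f (sync_update s c).
Proof.
rewrite (partition_big (sync_update s) predT) //=; apply: eq_bigr => s' _.
by rewrite mulr_suml; apply: eq_bigr => c /eqP ->.
Qed.

Lemma average_async s (f : config V -> R) :
  average (voter_kernel Asynchronous H) f s =
  \sum_v \sum_u #|V|%:R^-1 * H v u * f (async_update s v u).
Proof.
rewrite /average /= (eq_bigr _ (fun s' _ => mulr_suml _ _ _ _)) exchange_big /=.
apply: eq_bigr => v _.
rewrite (partition_big (async_update s v) predT) //=; apply: eq_bigr => s' _.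
by rewrite mulr_suml; apply: eq_bigr => u /eqP ->.
Qed.

(** Marginal at [v] of the product law: once [g] is absorbed into the factor of [v], the sum factors
    over the nodes, and every other factor is a row sum of [H]. *)
Lemma sum_prod_selection (v : V) (g : V -> R) :
  \sum_(c : {ffun V -> V}) (\prod_w H w (c w)) * g (c v) = \sum_u H v u * g u.
Proof.
transitivity (\sum_(c : {ffun V -> V})
    \prod_w (H w (c w) * (if w == v then g (c w) else 1))).
  apply: eq_bigr => c _; rewrite big_split /=; congr (_ * _).
  by rewrite -big_mkcond big_pred1_eq.
rewrite -(bigA_distr_bigA (fun w u => H w u * (if w == v then g u else 1))).
rewrite (bigD1 v) //= eqxx [X in _ * X]big1 ?mulr1 // => w /negPf wv.
by rewrite (eq_bigr (H w)) => [//|u _]; rewrite wv mulr1.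
Qed.

Hypothesis V0 : (0 < #|V|)%N.

(** With probability [update_rate] the node [v] pulls along row [v] of [H]; otherwise it keeps its
    state. *)
Lemma average_node sch s v (g : option color -> R) :
  average (voter_kernel sch H) (fun s' => g (s' v)) s =
  g (s v) + update_rate V sch * (\sum_u H v u * g (pull s v u) - g (s v)).
Proof.
case: sch.
  rewrite average_sync mul1r addrC subrK.
  rewrite -(sum_prod_selection v (fun u => g (pull s v u))).
  by apply: eq_bigr => c _; rewrite ffunE.
rewrite average_async (bigD1 v) //=.
under eq_bigr => u _ do rewrite ffunE eqxx -mulrA.
rewrite -mulr_sumr.
(* Each of the other [#|V| - 1] nodes, when chosen, leaves [v] alone. *)
under [X in _ + X]eq_bigr => w wv.
  under eq_bigr => u _ do rewrite ffunE eq_sym (negPf wv) mulrAC.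
  rewrite -mulr_sumr H1 mulr1.
  over.
rewrite sumr_const (cardC1 v) -subn1 -(mulr_natr (_ * _)) natrB //.
by field; rewrite pnatr_eq0 -lt0n.
Qed.

Lemma sum_voter_kernel sch s : \sum_(s' : config V) voter_kernel sch H s s' = 1.
Proof.
have /card_gt0P[v _] := V0.
transitivity (average (voter_kernel sch H) (fun s' => (fun=> 1) (s' v)) s).
  by apply: eq_bigr => s' _; rewrite mulr1.
rewrite (average_node sch s v (fun=> 1)); under eq_bigr => u _ do rewrite mulr1.
by rewrite H1 subrr mulr0 addr0.
Qed.

(** A gnostic node never turns agnostic again, so only configurations with [v] gnostic carry
    weight. *)
Lemma eq_average_gnostic sch (s : config V) v (f g : config V -> R) :
  s v <> None -> (forall s' : config V, s' v <> None -> f s' = g s') ->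
  average (voter_kernel sch H) f s = average (voter_kernel sch H) g s.
Proof.
move=> sv fg; have pullN u : pull s v u <> None by rewrite /pull; case: (s u).
case: sch; rewrite ?average_sync ?average_async.
  by apply: eq_bigr => c _; congr (_ * _); apply: fg; rewrite ffunE.
apply: eq_bigr => w _; apply: eq_bigr => u _; congr (_ * _); apply: fg.
by rewrite ffunE; case: eqP => [<-|].
Qed.

Lemma average_agnostic sch (f : config V -> R) :
  average (voter_kernel sch H) f [ffun=> None] = f [ffun=> None].
Proof.
rewrite -[RHS]mul1r -(sum_voter_kernel sch [ffun=> None]) mulr_suml.
have sc c : sync_update ([ffun=> None] : config V) c = [ffun=> None].
  by apply/ffunP => v; rewrite !ffunE /pull !ffunE.
have ac v u : async_update ([ffun=> None] : config V) v u = [ffun=> None].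
  by apply/ffunP => w; rewrite !ffunE /pull !ffunE if_same.
rewrite -[RHS]/(average _ (fun=> _) _).
case: sch; rewrite ?average_sync ?average_async.
  by apply: eq_bigr => c _; rewrite sc.
by apply: eq_bigr => w _; apply: eq_bigr => u _; rewrite ac.
Qed.

(** The hypothesis on [p] is the first-step equation of the probabilities of first becoming red. *)
Lemma average_weighted sch mu (p : V -> config V -> R) s :
  reversible H mu ->
  (forall v (s : config V), p v s = if s v is Some c then (c == red)%:R
                       else average (voter_kernel sch H) (p v) s) ->
  average (voter_kernel sch H) (fun s => \sum_v mu v * p v s) s =
  \sum_v mu v * p v s.
Proof.
move=> rev pE; rewrite average_sum; apply/eqP; rewrite -subr_eq0 -sumrB; apply/eqP.
pose G u : R := (s u != None)%:R.
pose r u : R := (s u == Some red)%:R.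
(* The drift as a double sum over gnostic pairs: [G v * G u] and, by reversibility, [mu v * H v u]
   are symmetric, while [r u - r v] is antisymmetric. *)
transitivity (\sum_v \sum_u update_rate V sch *
               (mu v * H v u * (G v * G u * (r u - r v)))); last first.
  apply: sum_antisymmetric => v w.
  have E : mu w * H w v = mu v * H v w by rewrite mulrC -rev mulrC.
  by rewrite E -(opprB (r w)) (mulrC (G v)) !mulrN.
apply: eq_bigr => v _; rewrite -mulrBr.
case E: (s v) => [c|]; last first.
  rewrite [p v s]pE E subrr mulr0 big1 // => u _.
  by rewrite /G E eqxx !(mul0r, mulr0).
(* For gnostic [v], [p v] is the indicator of red at [v], also after the round, so the one-node
   formula applies. *)
rewrite (eq_average_gnostic sch s v _ (fun s' => (s' v == Some red)%:R));
  [|by rewrite E|by move=> s'; rewrite pE; case: (s' v)].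
rewrite (average_node _ _ _ (fun o => (o == Some red)%:R)) [p v s]pE E.
rewrite [_ == red]/(Some c == Some red).
set x : R := (Some c == Some red)%:R.
have -> : \sum_u H v u * (pull s v u == Some red)%:R - x =
          \sum_u H v u * (G v * G u * (r u - r v)).
  (* Row [v] sums to 1, so [x] moves under the sum; an agnostic [u] leaves [v] unchanged and gives
     0. *)
  rewrite -[X in _ - X]mul1r -[X in _ - X * _](H1 v) mulr_suml -sumrB.
  apply: eq_bigr => u _; rewrite -mulrBr; congr (_ * _).
  rewrite /G /r /pull E /=; case: (s u) => [d|] /=.
    by rewrite !mul1r.
  by rewrite subrr mulr0 mul0r.
rewrite addrAC subrr add0r !mulr_sumr; apply: eq_bigr => u _.
by rewrite mulrCA !mulrA.
Qed.
End OneRound.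

(** * Stopping rules along paths *)

(* [d c = Some b] means that the path stops at [c] with outcome [b]; [hit_within]
   tests that it stops within [m] steps with outcome [true]. *)
Fixpoint hit_within {C : Type} (d : C -> option bool) (m : nat)
    (x : nat -> C) : bool :=
  match d (x 0%N) with
  | Some b => b
  | None => if m is m'.+1 then hit_within d m' (fun i => x i.+1) else false
  end.

Lemma hit_withinP (C : Type) (d : C -> option bool) (x : nat -> C) :
  (exists m, hit_within d m x) <->
  (exists t, d (x t) = Some true /\ forall i, (i < t)%N -> d (x i) = None).
Proof.
split=> [[m]|[t]].
  elim: m x => [|m IHm] x /=; case E: (d (x 0%N)) => [[]|] //.
  - by move=> _; exists 0%N.
  - by move=> _; exists 0%N.
  - by case/IHm => t [dt lt_t]; exists t.+1; split=> // -[_|i it]; [exact: E|exact: lt_t].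
elim: t x => [|t IHt] x /=; first by move=> [E _]; exists 0%N => /=; rewrite E.
move=> [dt lt_t]; have [|m hm] := IHt (fun i => x i.+1).
  by split=> // i it; apply: (lt_t i.+1).
by exists m.+1; rewrite /= (lt_t 0%N).
Qed.

Lemma hit_within_mono (C : Type) (d : C -> option bool) (x : nat -> C) m n :
  (m <= n)%N -> hit_within d m x -> hit_within d n x.
Proof.
elim: m n x => [|m IHm] [|n] x //=; case: (d (x 0%N)) => // mn.
exact: IHm.
Qed.

(** When [true] is the only outcome, the earliest visit to [P] is the required stop. *)
Lemma exists_first (C : Type) (P : pred C) (x : nat -> C) :
  (exists t, (if P (x t) then Some true else None) = Some true /\
     forall i, (i < t)%N -> (if P (x i) then Some true else None) = None) <->
  (exists t, P (x t)).
Proof.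
split=> [[t [Pt _]]|exP]; first by exists t; case: (P (x t)) Pt.
case: (ex_minnP exP) => t Pt t_min; exists t; rewrite Pt; split=> // i it.
by case: ifP => // /t_min; rewrite leqNgt it.
Qed.

(** Counterpart of [hit_within] for the kernel, by first-step recursion; it is 0 when the steps run
    out. *)
Fixpoint hit_prob {R : realType} {C : finType} (K : C -> C -> R)
    (d : C -> option bool) (m : nat) (s : C) : R :=
  match d s with
  | Some b => b%:R
  | None => if m is m'.+1 then average K (hit_prob K d m') s else 0
  end.

(** * Decomposition along a finite-valued map *)

Lemma ge0_integral_partition {disp} {T : measurableType disp} {R : realType}
    (P : measure T R) (I : finType) (Y : T -> I) (A : set T) (f : T -> \bar R) :
  (forall i, measurable (Y @^-1` [set i])) -> measurable A ->
  measurable_fun setT f -> (forall x, 0 <= f x)%E ->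
  (\int[P]_(x in A) f x = \sum_i \int[P]_(x in A `&` Y @^-1` [set i]) f x)%E.
Proof.
move=> mY mA mf f0.
have AE : A = \big[setU/set0]_(i <- index_enum I) (A `&` Y @^-1` [set i]).
  apply/seteqP; split=> w.
    by move=> Aw; rewrite -bigcup_seq; exists (Y w) => //=; rewrite mem_index_enum.
  by rewrite -bigcup_seq => -[i _ []].
rewrite [in LHS]AE ge0_integral_bigsetU //.
- by move=> i; apply: measurableI.
- exact: index_enum_uniq.
- by move=> i j _ _ [w [[_ /= <-] [_ /= <-]]].
- by rewrite -AE; apply: measurable_funS mf.
Qed.

Lemma measure_partition {disp} {T : measurableType disp} {R : realType}
    (P : measure T R) (I : finType) (Y : T -> I) (A : set T) :
  (forall i, measurable (Y @^-1` [set i])) -> measurable A ->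
  P A = (\sum_i P (A `&` Y @^-1` [set i]))%E.
Proof.
move=> mY mA; rewrite -[LHS]mul1e -integral_cst //.
rewrite (@ge0_integral_partition _ _ _ P I Y) //.
by apply: eq_bigr => i _; rewrite integral_cst ?mul1e //; apply: measurableI.
Qed.

(** * Finite-state Markov processes: cylinders and hitting events *)

Section Markov.
Context {R : realType} {C : finType} (K : C -> C -> R) (Z : process R C).
Hypothesis ZK : markov K Z.

Definition cylinder t (x : nat -> C) : set (space Z) :=
  [set w | forall i, (i <= t)%N -> state Z i w = x i].

Lemma measurable_state t c : measurable (state Z t @^-1` [set c]).
Proof. by case: ZK. Qed.

(** The state takes finitely many values, so it can be frozen at each of them. *)
Lemma measurable_state_dep t (F : C -> set (space Z)) :
  (forall c, measurable (F c)) -> measurable [set w | F (state Z t w) w].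
Proof.
move=> mF; have -> : [set w | F (state Z t w) w] =
    \bigcup_(c in [set: C]) (state Z t @^-1` [set c] `&` F c).
  apply/seteqP; split=> w /= => [Fw|[c _ [<-]] //].
  by exists (state Z t w).
apply: fin_bigcup_measurable => // c _.
by apply: measurableI => //; apply: measurable_state.
Qed.

Lemma measurable_cylinder t x : measurable (cylinder t x).
Proof.
have -> : cylinder t x = \bigcap_(i in `I_t.+1) (state Z i @^-1` [set x i]).
  by apply/seteqP; split=> w /= h i /=; apply: h.
apply: fin_bigcap_measurable; first exact: finite_II.
by move=> i _; apply: measurable_state.
Qed.

Lemma state_addSn k w :
  (fun i => state Z (i.+1 + k) w) = (fun i => state Z (i + k.+1) w).
Proof. by apply/funext => i; rewrite addSnnS. Qed.

Lemma measurable_hit_within d k m :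
  measurable [set w | hit_within d m (fun i => state Z (i + k) w)].
Proof.
elim: m k => [|m IHm] k /=.
  apply: (measurable_state_dep k (fun c =>
    [set w | is_true (if d c is Some b then b else false)])) => c.
  by case: (d c) => [[]|]; rewrite ?set_true ?set_false.
apply: (measurable_state_dep k (fun c => [set w |
    is_true (if d c is Some b then b
             else hit_within d m (fun i => state Z (i.+1 + k) w))])) => c.
case: (d c) => [[]|]; rewrite ?set_true ?set_false //.
by under eq_fun do rewrite state_addSn.
Qed.

Lemma law_fin_num (A : set (space Z)) : measurable A -> law Z A \is a fin_num.
Proof. by move=> mA; apply: fin_num_measure. Qed.

Lemma measurable_hit_shift d k m :
  measurable [set w | hit_within d m (fun i => state Z (i.+1 + k) w)].
Proof.
rewrite (_ : [set w | _] =
  [set w | hit_within d m (fun i => state Z (i + k.+1) w)]).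
  exact: measurable_hit_within.
by apply/funext => w; rewrite /= state_addSn.
Qed.

(** The Markov property at time [k]. In the induction on [m], splitting on the state at time [k.+1]
    lengthens the cylinder by one step, at the cost of a factor [K]. *)
Lemma law_cylinder_hit d k x m :
  law Z (cylinder k x `&` [set w | hit_within d m (fun i => state Z (i + k) w)]) =
  (law Z (cylinder k x) * (hit_prob K d m (x k))%:E)%E.
Proof.
have base (b : bool) : (law Z (cylinder k x `&` [set w | b]) =
    law Z (cylinder k x) * b%:R%:E)%E.
  by case: b; rewrite ?set_true ?set_false ?setIT ?setI0 ?measure0 ?mule1 ?mule0.
have stop (F : C -> space Z -> Prop) :
    cylinder k x `&` [set w | F (state Z k w) w] = cylinder k x `&` [set w | F (x k) w].
  by apply/seteqP; split=> w /= [h]; rewrite h.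
elim: m k x base stop => [|m IHm] k x base stop /=.
  rewrite (stop (fun c _ => is_true (if d c is Some b then b else false))).
  by case: (d (x k)).
rewrite (stop (fun c w =>
    is_true (if d c is Some b then b
             else hit_within d m (fun i => state Z (i.+1 + k) w)))).
case: (d (x k)) => [b|] //.
rewrite (@measure_partition _ _ _ _ _ (state Z k.+1)); last first.
- by apply: measurableI; [exact: measurable_cylinder|exact: measurable_hit_shift].
- by move=> c; apply: measurable_state.
rewrite -(fineK (law_fin_num _ (measurable_cylinder k x))) -EFinM mulr_sumr -sumEFin.
(* [y] is the path [x] up to time [k], continued by [c]. *)
apply: eq_bigr => c _; pose y i := if (i <= k)%N then x i else c.
have yk : y k = x k by rewrite /y leqnn.
have yk1 : y k.+1 = c by rewrite /y ltnn.
transitivity (law Z (cylinder k.+1 y `&`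
    [set w | hit_within d m (fun i => state Z (i + k.+1) w)])).
  congr (law Z _); apply/seteqP; split=> w /=.
    move=> [[wx hw] wc]; split; last by rewrite -state_addSn.
    move=> i; rewrite leq_eqVlt => /orP[/eqP ->|]; first by rewrite yk1.
    by rewrite ltnS /y => ik; rewrite ik wx.
  move=> [wy hw]; split; last by rewrite wy.
  split; first by move=> i ik; rewrite wy ?(leqW ik) // /y ik.
  by rewrite state_addSn.
rewrite IHm; last first.
- by move=> F; apply/seteqP; split=> w /= [h]; rewrite h.
- by case; rewrite ?set_true ?set_false ?setIT ?setI0 ?measure0 ?mule1 ?mule0.
have -> : law Z (cylinder k.+1 y) = (law Z (cylinder k x) * (K (x k) c)%:E)%E.
  have [_ /(_ k y)] := ZK; rewrite yk yk1 => ->; congr (law Z _ * _)%E.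
  by apply/seteqP; split=> w h i ik; rewrite h // /y ik.
by rewrite yk1 -(fineK (law_fin_num _ (measurable_cylinder k x))) -!EFinM mulrA.
Qed.

Lemma law_setI1 (A B : set (space Z)) : measurable A -> measurable B ->
  law Z B = 1%E -> law Z (B `&` A) = law Z A.
Proof.
move=> mA mB B1; rewrite setIC.
have AE : A = (A `&` B) `|` (A `&` ~` B) by rewrite -setIUr setUv setIT.
rewrite [in RHS]AE measureU; last 1 first.
- by rewrite -setIIr setICr setI0.
- rewrite [X in (_ + X)%E](_ : _ = 0)%E ?adde0 //.
  apply/eqP; rewrite -measure_le0.
  apply: (@le_trans _ _ (law Z (~` B))).
    apply: le_measure; rewrite ?inE; [| |exact: subIsetr].
      by apply: measurableI => //; apply: measurableC.
    exact: measurableC.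
  by rewrite probability_setC // B1 subee.
- exact: measurableI.
- by apply: measurableI => //; apply: measurableC.
Qed.

(** If [d] reads the state of [v], this is [first_red] by conversion, as [red] is [true]. *)
Definition first_hit d : set (space Z) :=
  [set w | exists t, d (state Z t w) = Some true /\
                     forall i, (i < t)%N -> d (state Z i w) = None].

Lemma first_hitE d :
  first_hit d = \bigcup_m [set w | hit_within d m (fun i => state Z (i + 0) w)].
Proof.
have add0 w : (fun i => state Z (i + 0) w) = (fun i => state Z i w).
  by apply/funext => i; rewrite addn0.
apply/seteqP; split=> w; first by move=> /hit_withinP[m hm]; exists m; rewrite //= add0.
by move=> [m _ /= hm]; apply/hit_withinP; exists m; rewrite -add0.
Qed.

Lemma measurable_first_hit d : measurable (first_hit d).
Proof.
by rewrite first_hitE; apply: bigcup_measurable => m _; apply: measurable_hit_within.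
Qed.

(** The time-0 cylinder at [s] has probability 1, so [hit_prob] is the probability of a hit within
    [m] steps, and these events increase to [first_hit]. Hence [K] and [s] alone determine the
    limit. *)
Lemma cvg_hit_prob d s : starts_at Z s ->
  hit_prob K d m s @[m --> \oo] --> fine (law Z (first_hit d)).
Proof.
move=> Zs; have Zs1 : law Z (cylinder 0 (fun=> s)) = 1%E.
  rewrite -[RHS]Zs; congr (law Z _); apply/seteqP; split=> w /= h; first exact: h.
  by move=> i; rewrite leqn0 => /eqP ->.
have hitE m : hit_prob K d m s =
    fine (law Z [set w | hit_within d m (fun i => state Z (i + 0) w)]).
  rewrite -(law_setI1 _ _ (measurable_hit_within d 0 m) (measurable_cylinder _ _) Zs1).
  by rewrite law_cylinder_hit Zs1 mul1e.
under eq_fun do rewrite hitE.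
apply: fine_cvg; rewrite fineK; last by apply: law_fin_num; apply: measurable_first_hit.
rewrite first_hitE; apply: nondecreasing_cvg_mu => //.
- by move=> m; apply: measurable_hit_within.
- by rewrite -first_hitE; apply: measurable_first_hit.
- by move=> m n mn; apply/subsetPset => w /=; exact: hit_within_mono.
Qed.

(** * Integrals of functions of the state, and the martingale property *)

Lemma measurable_fun_state (f : C -> R) t :
  measurable_fun setT (fun w => (f (state Z t w))%:E).
Proof.
move=> _ B mB; rewrite setTI.
apply: (measurable_state_dep t (fun c => [set w | B (f c)%:E])) => c.
have [Bc|nBc] := pselect (B (f c)%:E).
  by rewrite (_ : [set _ | _] = setT) //; apply/seteqP; split.
by rewrite (_ : [set _ | _] = set0) //; apply/seteqP; split.
Qed.

Lemma integral_state (f : C -> R) t (A : set (space Z)) :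
  measurable A -> (forall c, 0 <= f c) ->
  (\int[law Z]_(w in A) (f (state Z t w))%:E =
   \sum_c (f c)%:E * law Z (A `&` state Z t @^-1` [set c]))%E.
Proof.
move=> mA f0; rewrite (@ge0_integral_partition _ _ _ _ _ (state Z t)) //.
- apply: eq_bigr => c _; rewrite -integral_cst; last first.
    by apply: measurableI => //; apply: measurable_state.
  by apply: eq_integral => w /set_mem[_ /= ->].
- by move=> c; apply: measurable_state.
- exact: measurable_fun_state.
- by move=> w; rewrite lee_fin.
Qed.

(** The martingale identity for one fixed past: [f] is constant at time [t], and its one-step
    average is the same constant. *)
Lemma integral_cylinder (f : C -> R) t x :
  (forall c, 0 <= f c) -> average K f =1 f ->
  (\int[law Z]_(w in cylinder t x) (f (state Z t.+1 w))%:E =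
   \int[law Z]_(w in cylinder t x) (f (state Z t w))%:E)%E.
Proof.
move=> f0 fK; have mx := measurable_cylinder t x.
transitivity ((f (x t))%:E * law Z (cylinder t x))%E; last first.
  rewrite -integral_cst //; apply: eq_integral => w /set_mem h.
  by rewrite /= h.
rewrite integral_state // -fK /average.
have aE := fineK (law_fin_num _ mx); move: (fine _) aE => a aE.
rewrite -aE -EFinM mulr_suml -sumEFin; apply: eq_bigr => c _.
pose y i := if (i <= t)%N then x i else c.
have yt : y t = x t by rewrite /y leqnn.
have yt1 : y t.+1 = c by rewrite /y ltnn.
have -> : law Z (cylinder t x `&` state Z t.+1 @^-1` [set c]) =
          law Z (cylinder t.+1 y).
  congr (law Z _); apply/seteqP; split=> w /=.
    move=> [wx wc] i; rewrite leq_eqVlt => /orP[/eqP ->|]; first by rewrite yt1.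
    by rewrite ltnS /y => it; rewrite it wx.
  move=> wy; split; last by rewrite wy.
  by move=> i it; rewrite wy ?(leqW it) // /y it.
have [_ /(_ t y)] := ZK; rewrite yt yt1 /cylinder => ->.
have -> : [set w | forall i, (i <= t)%N -> state Z i w = y i] = cylinder t x.
  by apply/seteqP; split=> w h i it; rewrite h // /y it.
by rewrite -aE -!EFinM; congr EFin; rewrite [LHS]mulrCA [LHS]mulrC [f c * _]mulrC.
Qed.

Lemma sub_natural_filtration t :
  natural_filtration Z t `<=` measurable.
Proof.
apply: smallest_sub; first exact: sigma_algebra_measurable.
by move=> A [i [c [_ ->]]]; apply: measurable_state.
Qed.

(** The sets saturated for agreement of paths up to [t] form a sigma-algebra containing the
    generators. *)
Lemma natural_filtration_path t A : natural_filtration Z t A ->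
  forall w w', (forall i, (i <= t)%N -> state Z i w = state Z i w') ->
  A w -> A w'.
Proof.
pose D := [set A : set (space Z) | forall w w',
  (forall i, (i <= t)%N -> state Z i w = state Z i w') -> A w -> A w'].
suff : natural_filtration Z t `<=` D by move=> /[apply].
apply: smallest_sub.
  split; first by move=> w w' _ [].
    move=> B DB w w' ww' [_ nB]; split=> // Bw'; apply: nB.
    by apply: (DB w') Bw' => i it; rewrite ww'.
  by move=> F DF w w' ww' [n _ Fw]; exists n => //; apply: DF Fw.
by move=> B [i [c [it ->]]] w w' ww' /= <-; rewrite ww'.
Qed.

(** There are finitely many paths up to time [t], so an event of the past splits into cylinders. *)
Lemma martingale_harmonic (f : C -> R) :
  (forall c, 0 <= f c) -> average K f =1 f ->
  martingale Z (fun t w => f (state Z t w)).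
Proof.
move=> f0 fK; split.
- move=> t B mB; rewrite (_ : _ @^-1` _ =
      \bigcup_(c in [set c | B (f c)]) (state Z t @^-1` [set c])); last first.
    apply/seteqP; split=> w /=; last by move=> [c Bc /= ->].
    by move=> Bw; exists (state Z t w).
  apply: (@fin_bigcup_measurable _ (g_sigma_algebraType
    [set A | exists i c, (i <= t)%N /\ A = state Z i @^-1` [set c]])) => // c _.
  by apply: sub_sigma_algebra; exists t, c.
(* A nonnegative [f] is dominated by the constant sum of all its values. *)
- move=> t; have Icst := finite_measure_integrable_cst (law Z) (\sum_c f c) measurableT.
  apply: (le_integrable _ _ _ Icst) => //; first exact: measurable_fun_state.
  move=> w _; rewrite /= lee_fin !ger0_norm ?sumr_ge0 //.
  by rewrite (bigD1 (state Z t w)) //= lerDl sumr_ge0.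
- move=> t A At.
  have mA := sub_natural_filtration _ _ At.
  pose Y w : {ffun 'I_t.+1 -> C} := [ffun i => state Z (val i) w].
  have mY y : measurable (Y @^-1` [set y]).
    rewrite (_ : _ @^-1` _ = cylinder t (fun i => y (inord i))).
      exact: measurable_cylinder.
    apply/seteqP; split=> w /=.
      by move=> <- i it; rewrite ffunE /= inordK.
    move=> h; apply/ffunP => i; rewrite ffunE h; last exact: (ltn_ord i).
    by rewrite inord_val.
  have split_path s : (\int[law Z]_(w in A) (f (state Z s w))%:E =
      \sum_y \int[law Z]_(w in A `&` Y @^-1` [set y]) (f (state Z s w))%:E)%E.
    apply: ge0_integral_partition => //; first exact: measurable_fun_state.
    by move=> w; rewrite lee_fin.
  rewrite (split_path t.+1) (split_path t).
  apply: eq_bigr => y _.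
  (* Each piece is empty or the whole cylinder through one of its points. *)
  have [[w [Aw Yw]]|ny] := pselect (exists w, A w /\ Y w = y); last first.
    rewrite (_ : _ `&` _ = set0) ?integral_set0 //.
    by apply/seteqP; split=> // w [Aw Yw]; apply: ny; exists w.
  suff -> : A `&` Y @^-1` [set y] = cylinder t (fun i => state Z i w).
    exact: integral_cylinder.
  have YE w' : Y w' = y <-> forall i, (i <= t)%N -> state Z i w' = state Z i w.
    rewrite -Yw; split=> [/ffunP E i it|E].
      by have := E (Ordinal (it : (i < t.+1)%N)); rewrite !ffunE.
    by apply/ffunP => i; rewrite !ffunE E //; exact: (ltn_ord i).
  apply/seteqP; split=> w' /=; first by move=> [_ /YE].
  move=> h; split; last exact/YE.
  by apply: (natural_filtration_path _ _ At w) Aw => i it; rewrite h.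
Qed.
End Markov.

(** * Harmonic functions against hitting probabilities *)

Section HitProb.
Context {R : realType} {C : finType} (K : C -> C -> R).
Hypothesis K_ge0 : forall s s', 0 <= K s s'.

Lemma ler_average (f g : C -> R) s :
  (forall s', f s' <= g s') -> average K f s <= average K g s.
Proof. by move=> fg; apply: ler_sum => s' _; apply: ler_wpM2l. Qed.

Lemma hit_prob_ge0 d m s : 0 <= hit_prob K d m s.
Proof.
elim: m s => [|m IHm] s /=; case: (d s) => [b|] //; rewrite ?ler0n // /average.
by apply: sumr_ge0 => s' _; apply: mulr_ge0.
Qed.

(** Optional stopping at a finite horizon: the default 0 at the horizon lies below [f], and
    averaging preserves the bound. *)
Lemma hit_prob_le_harmonic d m (f : C -> R) s :
  (forall s, 0 <= f s) -> average K f =1 f ->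
  (forall s (b : bool), d s = Some b -> b%:R <= f s) -> hit_prob K d m s <= f s.
Proof.
move=> f0 fK df; elim: m s => [|m IHm] s /=; case E: (d s) => [b|] //;
  try exact: df.
by rewrite -fK; apply: ler_average.
Qed.

(** Where the path has ended, [f] is at most the indicator of [red_set]; where it has not, [f <= 1]
    is paid for by the probability of not having ended. *)
Lemma harmonic_le_hit_prob (red_set end_set : pred C) m (f : C -> R) s :
  (forall s, \sum_s' K s s' = 1) -> average K f =1 f -> (forall s, f s <= 1) ->
  (forall s, end_set s -> f s <= (red_set s)%:R) ->
  f s <= hit_prob K (fun s => if red_set s then Some true else None) m s
         + (1 - hit_prob K (fun s => if end_set s then Some true else None) m s).
Proof.
move=> K1 fK f1 fend.
have ended m' t : end_set t -> f t <=
    hit_prob K (fun s => if red_set s then Some true else None) m' t.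
  move=> /fend ft; apply: le_trans ft _; case E: (red_set t).
    by case: m' => /= [|?]; rewrite E.
  exact: hit_prob_ge0.
elim: m s => [|m IHm] s.
  have [es|/negPf es] := boolP (end_set s).
    by rewrite /= es subrr addr0; apply: (ended 0%N).
  by rewrite /= es subr0; apply: le_trans (f1 s) _; rewrite lerDr; case: ifP.
have [es|/negPf es] := boolP (end_set s).
  by rewrite [in X in _ - X]/= es subrr addr0; apply: ended.
rewrite /= es; case: ifP => [rs|_].
  (* In [red_set] but outside [end_set] the first term is 1; the second is nonnegative because the
     harmonic constant 1 bounds hitting probabilities. *)
  apply: le_trans (f1 s) _; rewrite lerDl subr_ge0 -(K1 s).
  apply: ler_sum => s' _; rewrite -[leRHS]mulr1; apply: ler_wpM2l => //.
  apply: hit_prob_le_harmonic => //.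
    by move=> t; rewrite -[RHS](K1 t); apply: eq_bigr => ? _; rewrite mulr1.
  by move=> t b; case: ifP => // _ [<-].
rewrite -fK -[X in _ + (X - _)](K1 s) -sumrB -big_split /=.
apply: ler_sum => s' _.
by rewrite -[X in _ + (X - _)]mulr1 -mulrBr -mulrDr; apply: ler_wpM2l.
Qed.

(** The recursion of [hit_prob] passes to the limit through a finite sum. *)
Lemma hit_prob_limit_step d (h : C -> R) s :
  (forall s, hit_prob K d m s @[m --> \oo] --> h s) ->
  h s = if d s is Some b then b%:R else average K h s.
Proof.
move=> hE; have := hE s; rewrite -cvg_shiftS => /cvg_lim <- //.
apply/cvg_lim => //=; case: (d s) => [b|]; first exact: cvg_cst.
apply: cvg_big; first by apply: add_continuous.
by move=> s' _; apply: cvgMr; apply: hE.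
Qed.

End HitProb.

(** * Martingale and winning probability for the voter model *)

Lemma voter_kernel_ge0 (R : realType) (V : finType) (H : V -> V -> R) sch s s' :
  (forall v u, 0 <= H v u) -> 0 <= voter_kernel sch H s s'.
Proof.
move=> H0; case: sch => /=; apply: sumr_ge0 => c _; first exact: prodr_ge0.
by apply: sumr_ge0 => u _; rewrite mulr_ge0 // invr_ge0.
Qed.

Theorem theorem3 (R : realType) (V : finType) (E : rel V) (H : V -> V -> R)
  (mu : V -> R) (sch : schedule) (from : config V -> process R (config V)) :
  strongly_connected E ->
  transition_matrix E H ->
  stationary H mu ->
  reversible H mu ->
  voter_family sch H from ->
  (forall Z : process R (config V), markov (voter_kernel sch H) Z ->
     martingale Z (fun t w => weighted_red from mu (state Z t w))) /\
  (always_converges from ->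
     forall (s0 : config V) (Z : process R (config V)),
       markov (voter_kernel sch H) Z -> starts_at Z s0 ->
       law Z (red_wins Z) = EFin (weighted_red from mu s0)).
Proof.
move=> _ [HE HnE H1] [mu0 mu1 _] rev fromK.
have H0 v u : 0 <= H v u.
  by have [/HE/ltW //|/HnE ->] := boolP (E v u).
have V0 : (0 < #|V|)%N.
  (* On an empty [V] the total mass of [mu] would be 0. *)
  rewrite lt0n; apply: contraPneq mu1 => /card0_eq V_empty.
  rewrite big1 => [/esym/eqP|v _]; first by rewrite oner_eq0.
  by have := V_empty v; rewrite inE.
pose K := voter_kernel sch H.
have K0 s s' : 0 <= K s s' by apply: voter_kernel_ge0.
have K1 s : \sum_s' K s s' = 1 by apply: sum_voter_kernel.
have pE v s : prob_red from v s =
    fine (law (from s) (first_hit (from s) (fun s => s v))) by [].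
have p_cvg v s :
    hit_prob K (fun s : config V => s v) m s @[m --> \oo] --> prob_red from v s.
  by rewrite pE; have [sK s0] := fromK s; apply: cvg_hit_prob.
have p_step v s : prob_red from v s =
    if s v is Some c then (c == red)%:R else average K (prob_red from v) s.
  rewrite (hit_prob_limit_step K (fun s : config V => s v)) //.
  by case: (s v) => [[]|].
have p0 v s : 0 <= prob_red from v s by apply: fine_ge0.
have p1 v s : prob_red from v s <= 1.
  have [sK _] := fromK s; have m_hit := measurable_first_hit _ _ sK (fun s => s v).
  by rewrite -lee_fin pE fineK ?probability_le1 //; apply: law_fin_num.
pose X := weighted_red from mu.
have X0 s : 0 <= X s by apply: sumr_ge0 => v _; apply: mulr_ge0.
have X1 s : X s <= 1.
  by rewrite -mu1; apply: ler_sum => v _; rewrite ler_piMr.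
have XK : average K X =1 X.
  by move=> s; apply: average_weighted.
split; first by move=> Z ZK; apply: martingale_harmonic ZK _ X0 XK.
move=> conv s0 Z ZK Zs0.
pose all_red (s : config V) := [forall v, s v == Some red].
pose all_same (s : config V) := [exists c, [forall v, s v == Some c]].
pose stop (P : pred (config V)) s := if P s then Some true else None.
have red_hit : red_wins Z = first_hit Z (stop all_red).
  apply/seteqP; split=> w.
    move=> [t wt]; apply/exists_first; exists t.
    by apply/forallP => v; rewrite wt.
  by move=> /exists_first[t /forallP wt]; exists t => v; apply/eqP.
have same_hit : consensus (from s0) = first_hit (from s0) (stop all_same).
  apply/seteqP; split=> w.
    move=> [t [c wt]]; apply/exists_first; exists t.
    by apply/existsP; exists c; apply/forallP => v; rewrite wt.
  move=> /exists_first[t /existsP[c /forallP wt]]; exists t, c => v.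
  exact/eqP.
have X_red s : all_red s -> X s = 1.
  move=> /forallP sr; rewrite -mu1; apply: eq_bigr => v _.
  by rewrite p_step (eqP (sr v)) mulr1.
have X_same s : all_same s -> X s <= (all_red s)%:R.
  move=> /existsP[[] /forallP sc].
    by rewrite (_ : all_red s) //; apply/forallP.
  by rewrite [X s]big1 // => v _; rewrite p_step (eqP (sc v)) mulr0.
have red_cvg := cvg_hit_prob _ _ ZK (stop all_red) _ Zs0.
(* [X] is harmonic, nonnegative and 1 on all-red configurations, so it bounds every [hit_prob] and
   their limit. *)
have L_le : fine (law Z (red_wins Z)) <= X s0.
  rewrite red_hit; apply: (cvgr_to_le red_cvg); near=> m.
  apply: hit_prob_le_harmonic => // s b; rewrite /stop.
  by case: ifP => // /X_red -> [<-].
rewrite -(fineK (x := law Z (red_wins Z))); last first.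
  by rewrite red_hit; apply: law_fin_num; apply: measurable_first_hit ZK _.
congr EFin; apply/eqP; rewrite eq_le L_le /=.
have [/existsP[v sv]|/existsPn s0N] := boolP [exists v, s0 v != None].
  (* Convergence is known for [from s0], which shares its kernel and start with [Z], hence also the
     values of [hit_prob]. *)
  have [sK ss] := fromK s0.
  have := cvg_hit_prob _ _ sK (stop all_same) _ ss.
  rewrite -same_hit conv; last by exists v; apply/eqP.
  move=> same_cvg.
  (* Consensus has probability 1, so the correction term vanishes in the limit. *)
  have : hit_prob K (stop all_red) m s0 + (1 - hit_prob K (stop all_same) m s0)
      @[m --> \oo] --> fine (law Z (red_wins Z)) + (1 - 1).
    rewrite red_hit; apply: cvgD => //; apply: cvgB => //; exact: cvg_cst.
  rewrite subrr addr0 => /cvgr_to_ge; apply; near=> m.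
  exact: harmonic_le_hit_prob.
(* Without gnostic nodes [s0] is absorbing, so every [prob_red] vanishes there and the bound reads
   0. *)
have s0E : s0 = [ffun=> None].
  by apply/ffunP => v; rewrite ffunE; apply/eqP; rewrite -[_ == _]negbK s0N.
rewrite [leLHS](_ : _ = 0) ?fine_ge0 //.
apply: big1 => v _; rewrite (_ : prob_red _ _ _ = 0) ?mulr0 //.
have hit0 m : hit_prob K (fun s : config V => s v) m s0 = 0.
  have s0v : s0 v = None by rewrite s0E ffunE.
  elim: m => [|m IHm]; rewrite /= s0v //.
  by rewrite s0E average_agnostic // -s0E.
have := p_cvg v s0; under eq_fun do rewrite hit0.
by move=> /cvg_lim <- //; rewrite lim_cst.
Unshelve. all: by end_near.
Qed.
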